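(* Let $f,g:\mathbb{R}\to\mathbb{R}$ be two polynomial functions of the same degree $d\geq 1$. Suppose that $f$ has only one critical point $t_0$, with multiplicity $k$, and that $g$ has only one critical point $s_0$, with the same multiplicity $k$. Also, suppose that $f(t_0)$ and $g(s_0)$ have the same sign (positive, negative or zero). (i) If $d$ is odd, then $f$ and $g$ are Lipschitz equivalent. (ii) If $d$ is even, then $f$ and $g$ are Lipschitz equivalent if and only if $t_0$ and $s_0$ are either both minimum points, or both maximum points, of $f$ and $g$, respectively.
   Context: Two nonzero polynomial functions $f,g:\mathbb{R}\to\mathbb{R}$ are Lipschitz equivalent, written $f\cong g$, if there exist a bi-Lipschitz homeomorphism $\phi:\mathbb{R}\to\mathbb{R}$ and a constant $c>0$ such that $g\circ\phi=cf$. Critical points are real points where the derivative vanishes. The multiplicity of a nonconstant polynomial function $f$ at a point $t_0\in\mathbb{R}$ is the order of vanishing of $f(t)-f(t_0)$ at $t=t_0$ (so critical points are the points of multiplicity $\geq 2$). *)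

(* Defs.v *)
From HB Require Import structures.
From mathcomp Require Export all_boot all_order all_algebra.
From mathcomp Require Export all_classical all_reals all_analysis.

Set Implicit Arguments.
Unset Strict Implicit.
Unset Printing Implicit Defensive.

Import Order.TTheory GRing.Theory Num.Theory.
Import numFieldNormedType.Exports.

Local Open Scope classical_set_scope.
Local Open Scope ring_scope.

(* A polynomial function R -> R is represented by its polynomial p : {poly R},
   as t |-> p.[t]; R being infinite, p is determined by the function. *)

Definition bilipschitz_homeo (R : realType) (phi : R -> R) : Prop :=
  exists psi : R -> R,
    [/\ cancel phi psi, cancel psi phi, continuous phi & continuous psi] /\
    (lipschitz (phi : R^o -> R^o) /\ lipschitz (psi : R^o -> R^o)).

(* Meant for nonzero f and g. *)
Definition lipschitz_equivalent (R : realType) (f g : {poly R}) : Prop :=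
  exists (phi : R -> R) (c : R),
    [/\ bilipschitz_homeo phi, 0 < c & forall t : R, g.[phi t] = c * f.[t]].

Definition critical_point (R : realType) (f : {poly R}) (t : R) : Prop :=
  f^`().[t] = 0.

Definition only_critical_point (R : realType) (f : {poly R}) (t0 : R) : Prop :=
  forall t : R, critical_point f t <-> t = t0.

(* Meant for nonconstant f: mup is a junk value on the zero polynomial. *)
Definition multiplicity (R : realType) (f : {poly R}) (t0 : R) : nat :=
  mup t0 (f - f.[t0]%:P).

Definition minimum_point (R : realType) (f : {poly R}) (t0 : R) : Prop :=
  forall t : R, f.[t0] <= f.[t].

Definition maximum_point (R : realType) (f : {poly R}) (t0 : R) : Prop :=
  forall t : R, f.[t] <= f.[t0].

(* Main.v *)
Require Import Defs.
From mathcomp Require Import all_boot all_order all_algebra.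
From mathcomp Require Import all_classical all_reals all_analysis.
From mathcomp Require Import ring lra.
From mathcomp Require polyorder polyrcf.
Import Order.TTheory GRing.Theory Num.Theory numFieldNormedType.Exports.
Local Open Scope ring_scope.

(** Around its unique critical point, f is determined up to bi-Lipschitz change
of variable by the degree d, the multiplicity k, the sign of f(t0) and, when d
is even, by the choice between minimum and maximum.

The derivative factors as f' = (X - t0)^(k-1) v, where v has no real root, so v
has constant sign and even degree d - k ([deriv_only_critical_point]); in
particular d and k have the same parity.  If v > 0 and t0 = 0, then v and its
reversal lie between positive constants on [0, 1], and so do v(-t) and its
reversal; hence in general |v(t0 + t)| is comparable to max(1, |t|)^(d-k) and
|f'(t0 + t)| to the weight
w(|t|) = |t|^(k-1) max(1, |t|)^(d-k), which depends on k and d only.  It follows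
that f(t0 + s) = f(t0) + e A(s) for k odd, and f(t0 + s) = f(t0) + e |A(s)| for k
even, where e = 1 or -1 and A is a bijection of the line that fixes 0 and
satisfies the two-sided estimate
  m |x - y| w(max(|x|, |y|)) <= |A x - A y| <= M |x - y| w(max(|x|, |y|))
([signed_power_form]).

Two bijections A and B obeying such an estimate for the same weight differ by a
bi-Lipschitz homeomorphism ([controlled_transfer]).  If B(phi x) = A(x), the
estimates at (x, 0) and (phi x, 0) show that |x| w(|x|) and |phi x| w(|phi x|)
are comparable, so that w(|x|) <= C w(|phi x|) because w is nondecreasing; the
estimates at (x, y) and (phi x, phi y) then bound |phi x - phi y| by a multiple
of |x - y|.  No derivative of phi enters.

Since f(t0) and g(s0) have the same sign, g(s0) = c f(t0) for some c > 0, and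
g o phi = c f amounts to B o phi = a A with a = e' c e when k is odd, and to
|B o phi| = c |A| when k is even and e = e'.  For even k the sign e distinguishes
minimum from maximum, and it is an invariant: an equivalence between opposite
signs would make the unbounded function |A| bounded. *)

(** * Maps with a prescribed weighted modulus *)

Definition is_weight {R : realType} (w : R -> R) : Prop :=
  [/\ 0 <= w 0, forall t : R, 0 < t -> 0 < w t &
      forall s t : R, 0 <= s -> s <= t -> w s <= w t].

(** This is the integrated form of the comparability of |A'(t)| with w(|t|);
stated on pairs of points, it applies to maps glued at 0 without any check of
differentiability there. *)
Definition controlled {R : realType} (w A : R -> R) : Prop :=
  exists m M : R, [/\ 0 < m, 0 < M & forall x y : R,
    m * (`|x - y| * w (Num.max `|x| `|y|)) <= `|A x - A y|
      <= M * (`|x - y| * w (Num.max `|x| `|y|))].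

Lemma weight_ge0 {R : realType} (w : R -> R) (t : R) :
  is_weight w -> 0 <= t -> 0 <= w t.
Proof. by case=> w0 _ wmono t0; apply: le_trans (wmono 0 t _ t0). Qed.

Lemma controlled_inj {R : realType} {w A : R -> R} :
  is_weight w -> controlled w A -> injective A.
Proof.
case=> _ wpos _ [m [M [m0 _ mM]]] x y Axy.
case: (eqVneq x y) => // xy.
have max0 : 0 < Num.max `|x| `|y|.
  rewrite lt_max !normr_gt0; case: (eqVneq x 0) => //= x0.
  by rewrite -x0 eq_sym.
have := mM x y; rewrite Axy subrr normr0 => /andP[le0 _].
have : 0 < m * (`|x - y| * w (Num.max `|x| `|y|)).
  by rewrite !mulr_gt0 ?wpos ?normr_gt0 ?subr_eq0.
by rewrite ltNge le0.
Qed.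

Lemma controlledZ {R : realType} {w A : R -> R} {a : R} :
  a != 0 -> controlled w A -> controlled w (fun x => a * A x).
Proof.
move=> a0 [m [M [m0 M0 mM]]]; have na0 : 0 < `|a| by rewrite normr_gt0.
exists (`|a| * m), (`|a| * M); split; rewrite ?mulr_gt0 // => x y.
by rewrite -mulrBr normrM -!(mulrA `|a|) !ler_pM2l.
Qed.

(** Comparing the two controls at (x, 0) and (phi x, 0) gives
w |x| <= C w |phi x|: if |x| <= |phi x| this is monotonicity, and otherwise the
factor |phi x| / |x| in the comparison is less than 1.  The weights then cancel when the controls
are compared at (x, y) and (phi x, phi y). *)
Lemma controlled_lipschitz {R : realType} {w A B phi : R -> R} :
  is_weight w -> controlled w A -> controlled w B -> A 0 = 0 -> B 0 = 0 ->
  (forall x, B (phi x) = A x) ->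
  exists K, forall x y : R, `|phi x - phi y| <= K * `|x - y|.
Proof.
move=> ww [m [M [m0 M0 mM]]] [m' [M' [m'0 M'0 mM']]] A0 B0 BA.
have [_ wpos wmono] := ww.
set C := Num.max 1 (M' / m).
have C1 : 1 <= C by rewrite le_max lexx.
have C0 : 0 < C by apply: lt_le_trans C1.
have wphi x : w `|x| <= C * w `|phi x|.
  have w0 := @weight_ge0 _ w `|phi x| ww (normr_ge0 _).
  have [le|lt] := leP `|x| `|phi x|.
    by apply: le_trans (wmono _ _ (normr_ge0 _) le) _; rewrite ler_peMl.
  have x0 : 0 < `|x| by apply: le_lt_trans lt.
  have /andP[l1 _] := mM x 0; have /andP[_ l2] := mM' (phi x) 0.
  move: l1 l2; rewrite A0 B0 BA !subr0 normr0 !(max_l (normr_ge0 _)) => l1 l2.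
  have l3 : `|x| * w `|x| <= `|x| * (C * w `|phi x|).
    have : `|x| * w `|x| <= M' / m * (`|phi x| * w `|phi x|).
      rewrite mulrAC ler_pdivlMr // mulrC; exact: le_trans l1 l2.
    move/le_trans; apply; rewrite [leRHS]mulrCA ler_pM ?mulr_ge0 ?invr_ge0 //.
    - by rewrite ltW.
    - by rewrite ltW.
    - by rewrite le_max lexx orbT.
    - by rewrite ler_wpM2r // ltW.
  by rewrite ler_pM2l in l3.
have wmax x y : w (Num.max `|x| `|y|) <= C * w (Num.max `|phi x| `|phi y|).
  have [_|_] := leP `|x| `|y|.
    apply: le_trans (wphi y) _; rewrite ler_pM2l //.
    by apply: wmono; rewrite // le_max lexx orbT.
  apply: le_trans (wphi x) _; rewrite ler_pM2l //.
  by apply: wmono; rewrite // le_max lexx.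
exists (M / m' * C) => x y.
have [->|xy] := eqVneq (phi x) (phi y).
  by rewrite subrr normr0 !mulr_ge0 ?invr_ge0 // ltW.
have max0 : 0 < Num.max `|phi x| `|phi y|.
  rewrite lt_max !normr_gt0; case: (eqVneq (phi x) 0) => //= x0.
  by rewrite -x0 eq_sym.
have W0 := wpos _ max0.
have /andP[_ l1] := mM x y; have /andP[l2 _] := mM' (phi x) (phi y).
rewrite -(ler_pM2r W0) -(ler_pM2l m'0); move: l2; rewrite !BA => l2.
apply: le_trans l2 (le_trans l1 _).
have -> : m' * (M / m' * C * `|x - y| * w (Num.max `|phi x| `|phi y|)) =
  M * (`|x - y| * (C * w (Num.max `|phi x| `|phi y|))).
  by field; rewrite gt_eqF.
by rewrite ler_pM2l // ler_wpM2l.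
Qed.

Lemma lipschitz_of_bound {R : realType} {phi : R -> R} {K : R} :
  (forall x y : R, `|phi x - phi y| <= K * `|x - y|) ->
  lipschitz (phi : R^o -> R^o) /\ continuous phi.
Proof.
move=> phiK; split.
  apply: (@klipschitzW _ R^o R^o K).
    by apply: (@globally_properfilter _ _ (0, 0)).
  by move=> [x y] _ /=; exact: phiK.
move=> x; apply/cvgrPdist_lt => e e0.
have K0 : 0 < Num.max 1 K by rewrite lt_max ltr01.
near=> y; apply: le_lt_trans (phiK x y) _.
apply: (@le_lt_trans _ _ (Num.max 1 K * `|x - y|)).
  by rewrite ler_wpM2r // le_max lexx orbT.
rewrite mulrC -ltr_pdivlMr //.
near: y; apply: cvgr_dist_lt => //; by rewrite divr_gt0.
Unshelve. all: by end_near.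
Qed.

(** The homeomorphism phi is phi0 = B^-1 o A, moved so that it sends the base
point t0 to s0; phi0 and its inverse are Lipschitz for the same reason, as A and
B play symmetric roles. *)
Lemma controlled_transfer {R : realType} {w A B : R -> R} (t0 s0 : R) :
  is_weight w -> controlled w A -> controlled w B -> A 0 = 0 -> B 0 = 0 ->
  (forall z, exists x, A x = z) -> (forall z, exists x, B x = z) ->
  exists2 phi : R -> R, bilipschitz_homeo phi &
    exists2 phi0 : R -> R, forall x, B (phi0 x) = A x &
      forall x, phi (t0 + x) = s0 + phi0 x.
Proof.
move=> ww cA cB A0 B0 surA surB.
have [phi phiP] := choice (fun x => surB (A x)).
have [psi psiP] := choice (fun x => surA (B x)).
have [K phiK] := controlled_lipschitz ww cA cB A0 B0 phiP.
have [L psiL] := controlled_lipschitz ww cB cA B0 A0 psiP.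
have phipsi : cancel phi psi.
  by move=> x; apply: (controlled_inj ww cA); rewrite psiP phiP.
have psiphi : cancel psi phi.
  by move=> x; apply: (controlled_inj ww cB); rewrite phiP psiP.
exists (fun t => s0 + phi (t - t0)); last first.
  by exists phi => // x; rewrite addrC (addrC t0) addrK addrC.
exists (fun s => t0 + psi (s - s0)).
have shift (a b : R) h J : (forall x y : R, `|h x - h y| <= J * `|x - y|) ->
  forall x y : R, `|(a + h (x - b)) - (a + h (y - b))| <= J * `|x - y|.
  move=> hJ x y.
  have -> : a + h (x - b) - (a + h (y - b)) = h (x - b) - h (y - b) by ring.
  have -> : x - y = (x - b) - (y - b) by ring.
  exact: hJ.
have [lphi cphi] := lipschitz_of_bound (shift s0 t0 _ _ phiK).
have [lpsi cpsi] := lipschitz_of_bound (shift t0 s0 _ _ psiL).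
split; split => //.
- by move=> x; rewrite (addrC s0) addrK phipsi addrC subrK.
- by move=> x; rewrite (addrC t0) addrK psiphi addrC subrK.
Qed.

(** * Positive polynomials on a half-line *)

Lemma poly_bounds01 {R : realType} {p : {poly R}} :
  (forall t : R, 0 <= t <= 1 -> 0 < p.[t]) ->
  exists m M : R,
    [/\ 0 < m, 0 < M & forall t : R, 0 <= t <= 1 -> m <= p.[t] <= M].
Proof.
move=> p0; have cp : {within `[0, 1], continuous (horner p)}%classic.
  by apply: continuous_subspaceT; exact: continuous_horner.
have [a a01 pa] := EVT_min ler01 cp; have [b b01 pb] := EVT_max ler01 cp.
exists p.[a], p.[b]; rewrite !in_itv /= in a01 b01; split; [exact: p0|exact: p0|].
by move=> t t01; rewrite pa ?pb // in_itv.
Qed.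

Definition reversal {R : realType} (v : {poly R}) : {poly R} :=
  \poly_(i < size v) v`_((size v).-1 - i).

Lemma horner_reversal {R : realType} (v : {poly R}) (t : R) :
  t != 0 -> v.[t] = t ^+ (size v).-1 * (reversal v).[t^-1].
Proof.
move=> t0; rewrite horner_poly horner_coef mulr_sumr.
rewrite (reindex_inj rev_ord_inj); apply: eq_bigr => i _ /=.
have -> : (size v - i.+1)%N = ((size v).-1 - i)%N by rewrite -subn1 -subnDA add1n.
have li : (i <= (size v).-1)%N by case: (size v) i => [[]|n []].
by rewrite mulrCA exprVn -expfB_cond ?(negPf t0).
Qed.

(** On [0, 1] this is compactness.  For t > 1, v(t) = t^n r(1/t) with r the
reversal of v, and r is positive on [0, 1] as well: at 0 its value is the leading
coefficient of v, which is nonzero, and cannot be negative by the intermediate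
value theorem. *)
Lemma positive_poly_bounds {R : realType} {v : {poly R}} :
  (forall t : R, 0 <= t -> 0 < v.[t]) ->
  exists m M : R, [/\ 0 < m, 0 < M & forall t : R, 0 <= t ->
    m * Num.max 1 t ^+ (size v).-1 <= v.[t]
      <= M * Num.max 1 t ^+ (size v).-1].
Proof.
move=> v0; set n := (size v).-1.
have vneq0 : v != 0.
  by apply: contraTneq (v0 0 (lexx 0)) => ->; rewrite horner0 ltxx.
have rpos s : 0 < s -> 0 < (reversal v).[s].
  move=> s0; have := v0 s^-1; rewrite invr_ge0 => /(_ (ltW s0)).
  rewrite horner_reversal ?invr_eq0 ?gt_eqF // invrK pmulr_rgt0 //.
  by rewrite exprn_gt0 // invr_gt0.
have r0 : (reversal v).[0] != 0.
  rewrite horner_coef0 coef_poly subn0 size_poly_gt0 vneq0.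
  by rewrite -/(lead_coef v) lead_coef_eq0.
have r01 s : 0 <= s <= 1 -> 0 < (reversal v).[s].
  case/andP; rewrite le_eqVlt => /predU1P[<- _|s0 _]; last exact: rpos.
  rewrite lt_neqAle eq_sym r0 leNgt; apply/negP => neg.
  have [|x x01 /rootP rx] := @poly_ivt _ (reversal v) 0 1 ler01.
    by rewrite !ltW ?rpos.
  have [x0|x0] := eqVneq x 0; first by rewrite x0 in rx; rewrite rx eqxx in r0.
  have := rpos x; rewrite rx ltxx lt_neqAle eq_sym x0 /=.
  by case/andP: x01 => -> _ /(_ isT).
have v01 s : 0 <= s <= 1 -> 0 < v.[s] by case/andP => s0 _; exact: v0.
have [m1 [M1 [m10 M10 b1]]] := poly_bounds01 v01.
have [m2 [M2 [m20 M20 b2]]] := poly_bounds01 r01.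
exists (Num.min m1 m2), (Num.max M1 M2); split.
- by rewrite lt_min m10.
- by rewrite lt_max M10.
move=> t t0; have [t1|t1] := leP t 1.
  have /andP[l u] := b1 t (introT andP (conj t0 t1)).
  by rewrite expr1n !mulr1 ge_min l le_max u.
have tt0 : 0 < t by apply: lt_trans t1.
have /andP[l u] : m2 <= (reversal v).[t^-1] <= M2.
  by apply: b2; rewrite invr_ge0 t0 invf_le1 // ltW.
rewrite horner_reversal ?gt_eqF // -/n !(mulrC _ (t ^+ n)) !ler_pM2l ?exprn_gt0 //.
by rewrite ge_min l le_max u !orbT.
Qed.

(** * The weight t^j max(1, t)^n *)

Definition growth_weight {R : realType} (j n : nat) (t : R) : R :=
  t ^+ j * Num.max 1 t ^+ n.

Lemma max1_ge0 {R : realType} (t : R) : 0 <= Num.max 1 t.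
Proof. by rewrite le_max ler01. Qed.

Lemma growth_weightP {R : realType} (j n : nat) :
  is_weight (growth_weight (R := R) j n).
Proof.
split=> [|t t0|s t s0 st].
- by rewrite mulr_ge0 ?exprn_ge0 ?max1_ge0.
- by rewrite mulr_gt0 ?exprn_gt0 // lt_max ltr01.
- rewrite ler_pM ?exprn_ge0 ?max1_ge0 // ?lerXn2r ?nnegrE ?max1_ge0 //.
  + exact: le_trans st.
  + by rewrite ge_max !le_max lexx st orbT.
Qed.

Lemma growth_weight_half {R : realType} (j n : nat) (t : R) : 0 <= t ->
  growth_weight j n t <= 2 ^+ (j + n) * growth_weight j n (t / 2).
Proof.
move=> t0; rewrite /growth_weight exprD mulrACA -!exprMn.
have -> : 2 * (t / 2) = t by field.
rewrite ler_wpM2l ?exprn_ge0 // lerXn2r ?nnegrE ?mulr_ge0 ?max1_ge0 //.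
rewrite maxr_pMr ?ler0n // ge_max !le_max.
by apply/andP; split; apply/orP; [left|right]; lra.
Qed.

(** * Polynomials with derivative X^j v on a half-line *)

Definition half_controlled {R : realType} (m M : R) (w P : R -> R) : Prop :=
  forall x y : R, 0 <= y -> y <= x ->
    m * ((x - y) * w x) <= P x - P y <= M * ((x - y) * w x).

(** The mean value theorem gives the upper bound with w x, but the lower bound
only with w y.  To replace w y by w x, the increment is bounded below by its part
over [max(y, x/2), x]: this interval has at least half the length of [y, x], and
the weight on it is at least w (x/2), which is a fixed fraction of w x. *)
Lemma half_controlled_poly {R : realType} {P v : {poly R}} {j : nat} :
  P^`() = 'X^j * v -> (forall t : R, 0 <= t -> 0 < v.[t]) ->
  exists m M : R, [/\ 0 < m, 0 < M &
    half_controlled m M (growth_weight j (size v).-1) (horner P)].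
Proof.
move=> dP /positive_poly_bounds[m [M [m0 M0 mM]]].
set n := (size v).-1; set w := growth_weight j n.
have [ww0 wpos wmono] := @growth_weightP R j n.
have dPw t : 0 <= t -> m * w t <= P^`().[t] <= M * w t.
  move=> t0; rewrite dP hornerM hornerXn /w /growth_weight !(mulrCA _ (t ^+ j)).
  by have /andP[l u] := mM t t0; rewrite !ler_wpM2l ?exprn_ge0.
have key (x y : R) : 0 <= y -> y <= x ->
    m * ((x - y) * w y) <= P.[x] - P.[y] <= M * ((x - y) * w x).
  move=> y0; rewrite le_eqVlt => /predU1P[->|yx].
    by rewrite !subrr !mul0r !mulr0 lexx.
  have [c] := polyrcf.mvt P yx; rewrite in_itv /= => /andP[yc cx] ->.
  have c0 : 0 <= c by apply: le_trans y0 (ltW yc).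
  have /andP[l u] := dPw c c0.
  rewrite !(mulrCA _ (x - y)) !(mulrC _ (x - y)) !ler_pM2l ?subr_gt0 //.
  apply/andP; split; [apply: le_trans l|apply: le_trans u _];
    by rewrite ler_pM2l // wmono // ltW.
exists (m / (2 * 2 ^+ (j + n))), M; split => //.
  by rewrite divr_gt0 // mulr_gt0 // exprn_gt0.
move=> x y y0 yx; have /andP[_ ->] := key _ _ y0 yx; rewrite andbT.
have x0 : 0 <= x by apply: le_trans yx.
have Wx : 0 <= w (x / 2) by apply: weight_ge0; [exact: growth_weightP|lra].
set z := Num.max y (x / 2).
have yz : y <= z by rewrite le_max lexx.
have zx : z <= x by rewrite ge_max yx; lra.
have xz : x / 2 <= z by rewrite le_max lexx orbT.
have xyz : (x - y) / 2 <= x - z by rewrite /z; have [?|?] := leP y (x / 2); lra.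
have z0 : 0 <= z by apply: le_trans yz.
have /andP[l1 _] := key _ _ y0 yz; have /andP[l2 _] := key _ _ z0 zx.
have l3 : 0 <= P.[z] - P.[y].
  have Wy : 0 <= w y by apply: weight_ge0 => //; exact: growth_weightP.
  by apply: le_trans l1; rewrite mulr_ge0 ?(ltW m0) // mulr_ge0 ?subr_ge0.
have l4 : m * ((x - y) / 2 * w (x / 2)) <= m * ((x - z) * w z).
  rewrite ler_pM2l // ler_pM //; first by rewrite divr_ge0 // subr_ge0.
  by apply: wmono => //; rewrite divr_ge0.
have -> : m / (2 * 2 ^+ (j + n)) * ((x - y) * w x) =
    m * ((x - y) / 2 * (w x / 2 ^+ (j + n))).
  by field; rewrite expf_neq0.
have l5 : m * ((x - y) / 2 * (w x / 2 ^+ (j + n))) <=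
    m * ((x - y) / 2 * w (x / 2)).
  rewrite ler_pM2l // ler_wpM2l ?divr_ge0 ?subr_ge0 //.
  by rewrite ler_pdivrMr ?exprn_gt0 // mulrC growth_weight_half.
lra.
Qed.

Lemma half_controlled_sur {R : realType} {m M : R} {j n : nat} {P : {poly R}} :
  0 < m -> half_controlled m M (growth_weight j n) (horner P) -> P.[0] = 0 ->
  forall z, 0 <= z -> exists2 x, 0 <= x & P.[x] = z.
Proof.
move=> m0 cP P0 z z0; set T := Num.max 1 (z / m).
have T1 : 1 <= T by rewrite le_max lexx.
have T0 : 0 <= T by apply: le_trans T1.
have PT : z <= P.[T].
  have /andP[+ _] := cP T 0 (lexx 0) T0; rewrite P0 !subr0; apply: le_trans.
  rewrite mulrC -ler_pdivrMr //.
  apply: (@le_trans _ _ T); first by rewrite le_max lexx orbT.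
  by rewrite ler_peMr // /growth_weight mulr_ege1 // ?exprn_ege1 // le_max lexx.
have [|x /andP[x0 _] /rootP] := @poly_ivt _ (P - z%:P) 0 T T0.
  by rewrite !hornerE P0; lra.
by rewrite !hornerE => /eqP; rewrite subr_eq0 => /eqP; exists x.
Qed.

(** * From half-lines to the line *)

Definition glue_halves {R : realType} (P Q : R -> R) (t : R) : R :=
  if 0 <= t then P t else - Q (- t).

(** For x and y of opposite signs the increment of the glued map is
P |x| + Q |y|, of which the part belonging to the larger of |x| and |y| already
accounts for half of (|x| + |y|) w(max(|x|, |y|)). *)
Lemma controlled_glue_halves {R : realType} {w P Q : R -> R} {mP MP mQ MQ : R} :
  is_weight w -> 0 < mP -> 0 < MP -> 0 < mQ -> 0 < MQ ->
  half_controlled mP MP w P -> half_controlled mQ MQ w Q ->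
  P 0 = 0 -> Q 0 = 0 -> controlled w (glue_halves P Q).
Proof.
move=> ww mP0 MP0 mQ0 MQ0 cP cQ P0 Q0.
have [_ _ wmono] := ww.
set m := Num.min mP mQ; set M := Num.max MP MQ.
have m0 : 0 < m by rewrite lt_min mP0.
have M0 : 0 < M by rewrite lt_max MP0.
have weaken (a A : R) (f : R -> R) : m <= a -> A <= M ->
    half_controlled a A w f -> half_controlled m M w f.
  move=> ma AM cf x y y0 yx; have /andP[l u] := cf x y y0 yx.
  have W : 0 <= (x - y) * w x.
    by rewrite mulr_ge0 ?subr_ge0 // weight_ge0 // (le_trans y0).
  apply/andP; split; [apply: le_trans l|apply: le_trans u _];
    exact: ler_wpM2r.
have {}cP : half_controlled m M w P.
  by apply: weaken cP; rewrite ?ge_min ?le_max lexx.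
have {}cQ : half_controlled m M w Q.
  by apply: weaken cQ; rewrite ?ge_min ?le_max lexx orbT.
have W t : 0 <= t -> 0 <= w t by exact: weight_ge0.
have same (f : R -> R) x y : half_controlled m M w f -> 0 <= x -> 0 <= y ->
    m / 2 * (`|x - y| * w (Num.max x y)) <= `|f x - f y|
      <= M * (`|x - y| * w (Num.max x y)).
  move=> cf; wlog yx : x y / y <= x.
    move=> H x0 y0; have /orP[yx|xy] := le_total y x; first exact: H.
    by rewrite distrC maxC (distrC (f x)); exact: H.
  move=> x0 y0; have /andP[l u] := cf x y y0 yx.
  have W0 : 0 <= (x - y) * w x by rewrite mulr_ge0 ?subr_ge0 ?W.
  have mW0 := mulr_ge0 (ltW m0) W0.
  rewrite max_l // ger0_norm ?subr_ge0 // ger0_norm; last exact: le_trans l.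
  by rewrite u andbT; lra.
have opp x y : 0 <= x -> 0 <= y ->
    m / 2 * ((x + y) * w (Num.max x y)) <= P x + Q y
      <= M * ((x + y) * w (Num.max x y)).
  move=> x0 y0.
  have /andP[] := cP x 0 (lexx 0) x0; have /andP[] := cQ y 0 (lexx 0) y0.
  rewrite P0 Q0 !subr0 => lQ uQ lP uP.
  have Wx := W _ x0; have Wy := W _ y0.
  have [xy|/ltW yx] := leP x y.
    have := wmono _ _ x0 xy => wxy.
    have h1 : x * w x <= x * w y by exact: ler_wpM2l.
    have h2 : m * (x * w y) <= m * (y * w y) by rewrite ler_pM2l // ler_wpM2r.
    have h3 : 0 <= m * (x * w x) by rewrite !mulr_ge0 // ltW.
    have h4 : M * (x * w x) <= M * (x * w y) by rewrite ler_pM2l.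
    by apply/andP; split; lra.
  have := wmono _ _ y0 yx => wxy.
  have h1 : y * w y <= y * w x by exact: ler_wpM2l.
  have h2 : m * (y * w x) <= m * (x * w x) by rewrite ler_pM2l // ler_wpM2r.
  have h3 : 0 <= m * (y * w y) by rewrite !mulr_ge0 // ltW.
  have h4 : M * (y * w y) <= M * (y * w x) by rewrite ler_pM2l.
  by apply/andP; split; lra.
exists (m / 2), M; split=> [||x y] //; first by rewrite divr_gt0.
rewrite /glue_halves; have [x0|/ltW x0] := leP 0 x; have [y0|/ltW y0] := leP 0 y.
- by rewrite (ger0_norm x0) (ger0_norm y0); exact: same.
- rewrite opprK (ger0_norm x0) (ler0_norm y0).
  have ny0 : 0 <= - y by rewrite oppr_ge0.
  have /andP[l u] := opp _ _ x0 ny0.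
  have h : 0 <= m / 2 * ((x - y) * w (Num.max x (- y))).
    rewrite !mulr_ge0 ?W ?le_max ?x0 //; first exact: ltW.
    by rewrite addr_ge0.
  have p0 := le_trans h l.
  by rewrite (ger0_norm p0) (@ger0_norm _ (x - y)) ?l ?u // addr_ge0.
- rewrite distrC (distrC _ (P y)) opprK (ler0_norm x0) (ger0_norm y0).
  have nx0 : 0 <= - x by rewrite oppr_ge0.
  have /andP[l u] := opp _ _ y0 nx0.
  have h : 0 <= m / 2 * ((y - x) * w (Num.max y (- x))).
    rewrite !mulr_ge0 ?W ?le_max ?y0 //; first exact: ltW.
    by rewrite addr_ge0.
  have p0 := le_trans h l.
  by rewrite maxC (ger0_norm p0) (@ger0_norm _ (y - x)) ?l ?u // addr_ge0.
- rewrite (ler0_norm x0) (ler0_norm y0).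
  have -> : x - y = - y - - x by ring.
  have -> : - Q (- x) - - Q (- y) = Q (- y) - Q (- x) by ring.
  by rewrite distrC (distrC (Q _)); apply: same; rewrite ?oppr_ge0.
Qed.

(** * Polynomials with a single critical point *)

Lemma rootfree_sgr {R : realType} {v : {poly R}} :
  (forall t, v.[t] != 0) -> forall t, 0 < Num.sg v.[0] * v.[t].
Proof.
move=> v0 t; have : 0 < v.[0] * v.[t].
  rewrite lt_neqAle eq_sym mulf_neq0 //= leNgt; apply/negP => neg.
  have /orP[t0|t0] := le_total 0 t; last rewrite mulrC in neg.
    by have [x _ /rootP /eqP] := polyrcf.poly_ivtoo t0 neg; rewrite (negPf (v0 x)).
  by have [x _ /rootP /eqP] := polyrcf.poly_ivtoo t0 neg; rewrite (negPf (v0 x)).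
by move=> vv; rewrite -sgr_gt0 sgrM sgr_id -sgrM sgr_gt0.
Qed.

(** If f - f(t0) = (X - t0)^k q with q(t0) nonzero, then
v = q' (X - t0) + k q takes the nonzero value k q(t0) at t0; elsewhere v vanishes
only where f' does, hence nowhere. *)
Lemma deriv_only_critical_point {R : realType} {f : {poly R}} {t0 : R}
    {d k : nat} :
  (1 <= d)%N -> size f = d.+1 -> only_critical_point f t0 ->
  multiplicity f t0 = k ->
  exists v : {poly R}, [/\ (1 < k)%N, (k + size v)%N = d.+1,
    f^`() = ('X - t0%:P) ^+ k.-1 * v & forall t, v.[t] != 0].
Proof.
move=> d1 sf crit; rewrite /multiplicity; set F := f - f.[t0]%:P => mk.
have F0 : F != 0.
  rewrite subr_eq0; apply/eqP => fc; move: sf d1.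
  by rewrite fc; have := size_polyC_leq1 f.[t0]; case: size => [|[|]] //= _ [<-].
have : ('X - t0%:P) ^+ k %| F by rewrite -mup_geq // mk.
case/dvdpP => q Fq.
have qt0 : q.[t0] != 0.
  apply/negP => /factor_theorem[r qr].
  have : (mup t0 F <= k)%N by rewrite mk.
  rewrite mup_leq // => /negP; apply; apply/dvdpP; exists r.
  by rewrite Fq qr -mulrA exprS.
have dfF : f^`() = F^`() by rewrite derivB derivC subr0.
have k0 : (0 < k)%N.
  case: k Fq {mk} => // Fq; move: qt0; have /(congr1 (horner ^~ t0)) := Fq.
  by rewrite expr0 mulr1 => <-; rewrite !hornerE subrr eqxx.
set v := q^`() * ('X - t0%:P) + k%:R *: q.
have dv : f^`() = ('X - t0%:P) ^+ k.-1 * v.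
  rewrite dfF Fq derivM deriv_exp derivXsubC mul1r -{1}(prednK k0) exprS /v.
  by rewrite -mulr_natl scaler_nat -mulr_natl; ring.
have vt0 : v.[t0] != 0.
  by rewrite !hornerE subrr mulr0 add0r mulf_neq0 // pnatr_eq0 -lt0n.
have k1 : (1 < k)%N.
  rewrite ltn_neqAle k0 andbT; apply/eqP => k1.
  have : critical_point f t0 by apply/crit.
  by rewrite /critical_point dv -k1 expr0 mul1r; apply/eqP.
have v0 t : v.[t] != 0.
  have [->//|tt0] := eqVneq t t0; apply/eqP => vt.
  have /crit tE : critical_point f t.
    by rewrite /critical_point dv hornerM vt mulr0.
  by rewrite tE eqxx in tt0.
exists v; split => //.
have : size f^`() = size (('X - t0%:P) ^+ k.-1 * v) by rewrite dv.
rewrite polyorder.size_deriv sf /= size_monicM ?monic_exp ?monicXsubC //; last first.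
  by apply: contraNneq vt0 => ->; rewrite horner0.
by rewrite size_exp_XsubC (prednK k0) => ->; rewrite prednK // addn_gt0 k0.
Qed.

(** With F(s) = f(t0 + s) - f(t0) and e the sign of v, the polynomials e F(s) and
(-1)^k e F(-s) both have a derivative of the form s^(k-1) times a positive
polynomial of degree d - k.  Gluing them gives A, which is e F for odd k and
e F(s) with the sign changed at negative s for even k. *)
Lemma signed_power_form {R : realType} {f : {poly R}} {t0 : R}
    {d k : nat} :
  (1 <= d)%N -> size f = d.+1 -> only_critical_point f t0 ->
  multiplicity f t0 = k ->
  odd d = odd k /\
  exists (e : R) (A : R -> R),
    [/\ e = 1 \/ e = - 1, controlled (growth_weight k.-1 (d - k)) A, A 0 = 0,
        forall z, exists x, A x = z &
        forall s, f.[t0 + s] =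
          f.[t0] + e * (if odd k then A s else `|A s|)].
Proof.
move=> d1 sf crit mk.
have [v [k1 sv dv v0]] := deriv_only_critical_point d1 sf crit mk.
have k0 : (0 < k)%N by apply: ltnW.
split.
  have : odd (size v).
    apply/negPn/negP => /polyrcf.odd_poly_root[x /rootP/eqP].
    by rewrite (negPf (v0 x)).
  by have := congr1 odd sv; rewrite oddD /=; case: odd; case: odd; case: odd.
set v1 := v \Po ('X + t0%:P).
have v10 t : v1.[t] != 0 by rewrite horner_comp.
have sv1 : (size v1).-1 = (d - k)%N.
  rewrite size_comp_poly2 ?size_XaddC //.
  by rewrite -subn1 -[size v](addKn k) sv subnAC subn1.
set F := (f \Po ('X + t0%:P)) - f.[t0]%:P.
have dF : F^`() = 'X^(k.-1) * v1.
  rewrite derivB derivC subr0 deriv_comp derivD derivX derivC addr0 mulr1 dv.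
  by rewrite comp_polyM rmorphXn /= comp_polyB comp_polyX comp_polyC addrK.
have FE s : F.[s] = f.[t0 + s] - f.[t0].
  rewrite hornerD hornerN hornerC horner_comp hornerD hornerX hornerC.
  by rewrite (addrC s).
set e := Num.sg v1.[0].
have e1 : e = 1 \/ e = -1.
  have := v10 0; rewrite /e; case: sgrP => //; by [left|right|rewrite eqxx].
have ee : e * e = 1 by case: e1 => ->; rewrite ?mulrNN mulr1.
have e0 : e != 0 by case: e1 => ->; rewrite ?oppr_eq0 oner_eq0.
have ev t : 0 < e * v1.[t] by exact: rootfree_sgr.
pose P := e *: F; pose Q := (e * (-1) ^+ k) *: (F \Po - 'X).
have dP : P^`() = 'X^(k.-1) * (e *: v1) by rewrite derivZ dF -scalerAr.
have dQ : Q^`() = 'X^(k.-1) * (e *: (v1 \Po - 'X)).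
  rewrite derivZ deriv_comp derivN derivX dF comp_polyM comp_Xn_poly.
  rewrite (exprNn 'X) -{1}(prednK k0) exprS -!mul_polyC !polyCM.
  rewrite rmorphXn /= polyCN.
  set a := (-1 : {poly R}) ^+ k.-1.
  have aa : a * a = 1 by rewrite /a -exprMn mulrNN mulr1 expr1n.
  transitivity (a * a * ('X^(k.-1) * (e%:P * (v1 \Po - 'X)))); first by ring.
  by rewrite aa mul1r.
have sP : (size (e *: v1)).-1 = (d - k)%N by rewrite size_scale.
have sQ : (size (e *: (v1 \Po - 'X))).-1 = (d - k)%N.
  by rewrite size_scale // size_comp_poly2 // size_polyN size_polyX.
have [|mP [MP [mP0 MP0]]] := half_controlled_poly dP.
  by move=> t _; rewrite hornerZ ev.
have [|mQ [MQ [mQ0 MQ0]]] := half_controlled_poly dQ.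
  by move=> t _; rewrite hornerZ horner_comp ev.
rewrite sP sQ => cQ cP.
have ww := @growth_weightP R k.-1 (d - k).
have PE s : P.[s] = e * F.[s] by rewrite hornerZ.
have QE s : Q.[- s] = e * (-1) ^+ k * F.[s].
  by rewrite hornerZ horner_comp !hornerE opprK.
have F0 : F.[0] = 0 by rewrite FE addr0 subrr.
have P0 : P.[0] = 0 by rewrite PE F0 mulr0.
have Q0 : Q.[0] = 0 by rewrite -[0]oppr0 QE oppr0 F0 mulr0.
have ge0 (m M : R) (p : {poly R}) (s : R) : 0 < m ->
    half_controlled m M (growth_weight k.-1 (d - k)) (horner p) ->
    p.[0] = 0 -> 0 <= s -> 0 <= p.[s].
  move=> m0 cp p0 s0; have /andP[+ _] := cp s 0 (lexx 0) s0.
  rewrite p0 !subr0; apply: le_trans.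
  by rewrite mulr_ge0 ?(ltW m0) // mulr_ge0 // weight_ge0.
exists e, (glue_halves (horner P) (horner Q)); split => //.
- exact: (controlled_glue_halves ww mP0 MP0 mQ0 MQ0 cP cQ P0 Q0).
- by rewrite /glue_halves lexx.
- move=> z; have [z0|z0] := leP 0 z.
    have [x x0 Px] := half_controlled_sur mP0 cP P0 z z0.
    by exists x; rewrite /glue_halves x0.
  have [|x x0 Qx] := half_controlled_sur mQ0 cQ Q0 (- z).
    by rewrite oppr_ge0 ltW.
  exists (- x); rewrite /glue_halves oppr_ge0 opprK Qx opprK ifN //.
  rewrite -ltNge lt_neqAle x0 andbT; apply: contraTneq z0 => xx.
  by rewrite -(opprK z) -Qx -xx Q0 oppr0 ltxx.
- move=> s; have -> : f.[t0 + s] = f.[t0] + F.[s] by rewrite FE addrCA subrr addr0.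
  congr (_ + _); rewrite /glue_halves; have [s0|s0] := leP 0 s.
    by rewrite (ger0_norm (ge0 _ _ _ _ mP0 cP P0 s0)) if_same PE mulrA ee mul1r.
  have ns0 : 0 <= - s by rewrite oppr_ge0 ltW.
  rewrite normrN (ger0_norm (ge0 _ _ _ _ mQ0 cQ Q0 ns0)) QE -signr_odd.
  case: (odd k); rewrite ?expr1 ?expr0 ?mulrN1 ?mulNr ?opprK ?mulr1;
    by rewrite mulrA ee mul1r.
Qed.

Theorem proposition2 (R : realType) (d k : nat) (f g : {poly R}) (t0 s0 : R)
  (hd : (1 <= d)%N)
  (hdegf : size f = d.+1) (hdegg : size g = d.+1)
  (hcritf : only_critical_point f t0) (hcritg : only_critical_point g s0)
  (hmultf : multiplicity f t0 = k) (hmultg : multiplicity g s0 = k)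
  (hsign : Num.sg f.[t0] = Num.sg g.[s0]) :
  (odd d -> lipschitz_equivalent f g) /\
  (~~ odd d ->
    (lipschitz_equivalent f g <->
     (minimum_point f t0 /\ minimum_point g s0) \/
     (maximum_point f t0 /\ maximum_point g s0))).
Proof.
have [odk [e [A [e1 cA A0 surA fE]]]] :=
  signed_power_form hd hdegf hcritf hmultf.
have [_ [e' [B [e'1 cB B0 surB gE]]]] :=
  signed_power_form hd hdegg hcritg hmultg.
have ww := @growth_weightP R k.-1 (d - k).
have fE' t : f.[t] = f.[t0] + e * (if odd k then A (t - t0) else `|A (t - t0)|).
  by rewrite -fE addrC subrK.
have gE' t : g.[t] = g.[s0] + e' * (if odd k then B (t - s0) else `|B (t - s0)|).
  by rewrite -gE addrC subrK.
have [c c0 cfg] : exists2 c, 0 < c & g.[s0] = c * f.[t0].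
  have [f0|f0] := eqVneq f.[t0] 0.
    exists 1; rewrite // f0 mulr0; apply/eqP.
    by rewrite -sgr_eq0 -hsign f0 sgr0.
  exists (g.[s0] / f.[t0]); last by rewrite divfK.
  by rewrite -sgr_gt0 sgrM sgrV -hsign -expr2 sqr_sg f0.
have e0 : e != 0 by case: e1 => ->; rewrite ?oppr_eq0 oner_eq0.
have e'0 : e' != 0 by case: e'1 => ->; rewrite ?oppr_eq0 oner_eq0.
have ee' : e' * e' = 1 by case: e'1 => ->; rewrite ?mulrNN mulr1.
(* phi is the transfer from a A to B, where the factor a corrects both the
   scale c and, for odd k, a difference of sign between e and e'. *)
have equiv : odd k \/ e = e' -> lipschitz_equivalent f g.
  move=> sgn; set a := e' * c * e.
  have a0 : a != 0 by rewrite !mulf_neq0 // gt_eqF.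
  have caA := controlledZ a0 cA.
  have suraA z : exists x, a * A x = z.
    by have [x Ax] := surA (z / a); exists x; rewrite Ax mulrC divfK.
  have aA0 : a * A 0 = 0 by rewrite A0 mulr0.
  have [phi bphi [phi0 phi0P phiE]] :=
    controlled_transfer t0 s0 ww caA cB aA0 B0 suraA surB.
  exists phi, c; split => // t.
  have -> : t = t0 + (t - t0) by rewrite addrC subrK.
  rewrite phiE fE gE phi0P cfg mulrDr; congr (_ + _).
  case: ifP sgn => [_ _|_ [//|ee]].
    by rewrite /a !mulrA ee' mul1r.
  have ac : a = c by rewrite /a ee mulrAC ee' mul1r.
  by rewrite ac normrM (gtr0_norm c0) ee mulrCA.
rewrite odk; split=> [ok|ek]; first by apply: equiv; left.
rewrite (negPf ek) in fE fE' gE gE' *.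
split=> [[phi [a [_ a0 conj]]]|mm].
  (* If e' = - e, then g o phi = a f reads a |A| + |B o phi| = constant, which is
     impossible since A is onto. *)
  have ee : e = e'.
    apply/eqP; apply/negPn/negP => ne.
    have e'N : e' = - e.
      by case: e1 e'1 ne => -> [] ->; rewrite ?eqxx ?opprK.
    have esq : e * e = 1 by case: e1 => ->; rewrite ?mulrNN mulr1.
    have bound t : a * `|A t| <= e * (g.[s0] - a * f.[t0]).
      have := conj (t0 + t); rewrite fE gE' e'N.
      set b := `|B _| => E.
      have b0 : 0 <= b by rewrite normr_ge0.
      have : a * `|A t| + b = e * (g.[s0] - a * f.[t0]).
        transitivity (e * e * (a * `|A t| + b)); first by rewrite esq mul1r.
        rewrite -mulrA; congr (_ * _); lra.
      lra.
    set K := e * _ in bound.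
    have [x Ax] := surA ((`|K| + 1) / a).
    have := bound x; rewrite Ax ger0_norm ?divr_ge0 ?addr_ge0 ?(ltW a0) //.
    by rewrite mulrC divfK ?gt_eqF // => le; have := ler_norm K; lra.
  rewrite -ee in gE'; case: e1 => e1; [left|right]; split=> t.
  - by rewrite (fE' t) e1 mul1r lerDl.
  - by rewrite (gE' t) e1 mul1r lerDl.
  - by rewrite (fE' t) e1 mulN1r gerDl oppr_le0.
  - by rewrite (gE' t) e1 mulN1r gerDl oppr_le0.
apply: equiv; right.
have [x Ax] := surA 1; have [y By] := surB 1.
have fx := fE x; have gy := gE y.
rewrite Ax normr1 mulr1 in fx; rewrite By normr1 mulr1 in gy.
case: mm => -[/(_ (t0 + x)) mf /(_ (s0 + y)) mg]; move: mf mg; rewrite fx gy;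
  by case: e1 e'1 => -> [] ->; lra.
Qed.
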